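(* Let $A$ be an algebra of the variety $\mathcal{V}$ such that $K(A)$ is closed under the commutator operation. Then: (1) if $\theta$ is a regular congruence of $A$ then $\theta^{\ast}$ is a regular ideal of $L(A)$; (2) assume that $A$ is semiprime; if $I$ is a regular ideal of $L(A)$ then $I_{\ast}$ is a regular congruence of $A$.
   Context: $\mathcal{V}$ is a fixed congruence-modular variety of algebras (of a finite signature) that is semidegenerate: no nontrivial algebra in $\mathcal{V}$ has one-element subalgebras (equivalently, $\nabla_A$ is compact in $Con(A)$ for every $A\in\mathcal{V}$). For $A\in\mathcal{V}$, $Con(A)$ is the complete lattice of congruences of $A$, with least element $\Delta_A$ and greatest element $\nabla_A$; $K(A)$ is the set of compact (= finitely generated) congruences. Commutator: $[\cdot,\cdot]=[\cdot,\cdot]_A$ is the (modular) commutator, i.e. the greatest operation on the congruence lattices of members of $\mathcal{V}$ such that for every surjective morphism $f:A\to B$ in $\mathcal{V}$ and all $\alpha,\beta\in Con(A)$: $[\alpha,\beta]_A\subseteq\alpha\cap\beta$ and $[\alpha,\beta]_A\vee Ker(f)=f^{-1}([f(\alpha\vee Ker(f)),f(\beta\vee Ker(f))]_B)$. $\phi\in Con(A)\setminus\{\nabla_A\}$ is prime if $[\alpha,\beta]\subseteq\phi$ implies $\alpha\subseteq\phi$ or $\beta\subseteq\phi$ (for $\alpha,\beta\in Con(A)$); $Spec(A)$ is the set of prime congruences; $\rho(\theta)=\bigcap\{\phi\in Spec(A)\mid\theta\subseteq\phi\}$; $A$ is semiprime if $\rho(\Delta_A)=\Delta_A$. Reticulation: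 when $K(A)$ is closed under the commutator, $L(A)=K(A)/{\equiv}$ where $\alpha\equiv\beta$ iff $\rho(\alpha)=\rho(\beta)$; $\lambda_A:K(A)\to L(A)$ is the quotient map; $L(A)$ is a bounded distributive lattice with $\lambda_A(\alpha)\vee\lambda_A(\beta)=\lambda_A(\alpha\vee\beta)$, $\lambda_A(\alpha)\wedge\lambda_A(\beta)=\lambda_A([\alpha,\beta])$, $0=\lambda_A(\Delta_A)$, $1=\lambda_A(\nabla_A)$. For $\theta\in Con(A)$, $\theta^{\ast}=\{\lambda_A(\alpha)\mid\alpha\in K(A),\alpha\subseteq\theta\}$, an ideal of $L(A)$; for an ideal $I$ of $L(A)$, $I_{\ast}=\bigvee\{\alpha\in K(A)\mid\lambda_A(\alpha)\in I\}\in Con(A)$. $B(Con(A))$ is the set of complemented elements of the lattice $Con(A)$. A congruence of $A$ is regular if it is the join of a family of elements of $B(Con(A))$. An ideal of a bounded distributive lattice $L$ is regular if it is generated by a set of complemented elements of $L$. *)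

(* Defs.v *)
From HB Require Import structures.
Set Warnings "-notation-overridden,-redundant-canonical-projection,-projection-no-head-constant".
From mathcomp Require Import all_boot all_order.
From mathcomp Require Import boolp classical_sets cardinality.

Set Implicit Arguments.
Unset Strict Implicit.
Unset Printing Implicit Defensive.

Import Order.TTheory.
Local Open Scope classical_set_scope.

Section Lattices.
Local Open Scope order_scope.

Definition modular d (L : latticeType d) :=
  forall x y z : L, x <= z -> x `|` (y `&` z) = (x `|` y) `&` z.

Definition complemented d (L : tbLatticeType d) (x : L) :=
  exists y : L, x `&` y = \bot /\ x `|` y = \top.

Definition lattice_ideal d (L : tbLatticeType d) (I : set L) :=
  [/\ I \bot,
      forall x y, x <= y -> I y -> I x
    & forall x y, I x -> I y -> I (x `|` y)].

Definition ideal_generated d (L : tbLatticeType d) (S : set L) : set L :=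
  [set x | forall J : set L, lattice_ideal J -> S `<=` J -> J x].

Definition regular_ideal d (L : tbDistrLatticeType d) (I : set L) :=
  lattice_ideal I /\
  exists S : set L, S `<=` [set x | complemented x] /\ I = ideal_generated S.

End Lattices.

Record signature := Signature { symbol : finType; arity : symbol -> nat }.

Record algebra (s : signature) := Algebra {
  carrier :> Type;
  op : forall f : symbol s, ('I_(arity f) -> carrier) -> carrier;
  carrier_inhabited : inhabited carrier }.

Definition is_hom (s : signature) (A B : algebra s) (h : A -> B) :=
  forall (f : symbol s) (x : 'I_(arity f) -> A),
    h (op x) = op (fun i => h (x i)).

Record surj_hom (s : signature) (A B : algebra s) := SurjHom {
  surj_fun :> A -> B;
  surj_is_hom : is_hom surj_fun;
  surj_surj : forall b, exists a, surj_fun a = b }.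

Definition subuniverse (s : signature) (A : algebra s) (S : set A) :=
  S !=set0 /\
  forall (f : symbol s) (x : 'I_(arity f) -> A), (forall i, S (x i)) -> S (op x).

Lemma prod_inhabited (s : signature) (I : Type) (A : I -> algebra s) :
  inhabited (forall i, A i).
Proof.
have H i : exists a : A i, True by have [a] := carrier_inhabited (A i); exists a.
by constructor => i; have [a _] := cid (H i).
Qed.

Definition prod_algebra (s : signature) (I : Type) (A : I -> algebra s) :
    algebra s :=
  @Algebra s (forall i, A i) (fun f x i => op (fun j => x j i))
    (prod_inhabited A).

(* Closure under H, S and P; a subalgebra is given, up to isomorphism, by an
   injective homomorphism. *)
Record variety (s : signature) (V : algebra s -> Prop) : Prop := Variety {
  variety_image : forall A B : algebra s, surj_hom A B -> V A -> V B;
  variety_sub : forall (A B : algebra s) (h : B -> A),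
    is_hom h -> injective h -> V A -> V B;
  variety_prod : forall (I : Type) (A : I -> algebra s),
    (forall i, V (A i)) -> V (prod_algebra A) }.

(* Carriers being nonempty, the trivial algebras are the one-element ones. *)
Definition nontrivial (s : signature) (A : algebra s) := exists x y : A, x <> y.

Definition semidegenerate (s : signature) (V : algebra s -> Prop) :=
  forall A : algebra s, V A -> nontrivial A ->
    ~ exists a : A, subuniverse [set a].

Record is_congr (s : signature) (A : algebra s) (R : A -> A -> Prop) : Prop :=
  IsCongr {
    congr_refl : forall a, R a a;
    congr_sym : forall a b, R a b -> R b a;
    congr_trans : forall a b c, R a b -> R b c -> R a c;
    congr_op : forall (f : symbol s) (x y : 'I_(arity f) -> A),
      (forall i, R (x i) (y i)) -> R (op x) (op y) }.

Record congr (s : signature) (A : algebra s) := Congr {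
  congr_rel :> A -> A -> Prop;
  congrP : is_congr congr_rel }.

Lemma congr_ext (s : signature) (A : algebra s) (t u : congr A) :
  (forall a b, t a b <-> u a b) -> t = u.
Proof.
case: t u => [R HR] [R' HR'] /= H.
have E : R = R' by apply/funext => a; apply/funext => b; apply/propext.
by case: _ / E HR' => HR'; congr Congr; exact: Prop_irrelevance.
Qed.

HB.instance Definition _ (s : signature) (A : algebra s) :=
  gen_eqMixin (congr A).
HB.instance Definition _ (s : signature) (A : algebra s) :=
  gen_choiceMixin (congr A).

Section CongruenceLattice.
Variables (s : signature) (A : algebra s).
Implicit Types (t u v : congr A) (S : set (congr A)).

Fact Delta_subproof : is_congr (fun a b : A => a = b).
Proof.
split=> // [a b c -> -> //|f x y xy].
by congr op; apply/funext => i.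
Qed.
Definition Delta : congr A := Congr Delta_subproof.

Fact Nabla_subproof : is_congr (fun a b : A => True).
Proof. by split. Qed.
Definition Nabla : congr A := Congr Nabla_subproof.

Fact Meet_subproof S : is_congr (fun a b => forall t, S t -> t a b).
Proof.
split=> [a t _|a b H t St|a b c H K t St|f x y H t St].
- exact: (congr_refl (congrP t) a).
- exact: (congr_sym (congrP t) (H _ St)).
- exact: (congr_trans (congrP t) (H _ St) (K _ St)).
- by apply: (congr_op (congrP t)) => i; exact: H.
Qed.
Definition Meet S : congr A := Congr (Meet_subproof S).

Definition congr_le t u : bool := `[< forall a b, t a b -> u a b >].

Definition Join S : congr A :=
  Meet [set t | forall u, S u -> congr_le u t].

Fact congr_le_refl : reflexive congr_le.
Proof. by move=> t; apply/asboolP. Qed.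
Fact congr_le_anti : antisymmetric congr_le.
Proof.
move=> t u /andP[/asboolP tu /asboolP ut]; apply: congr_ext => a b.
by split; [exact: tu|exact: ut].
Qed.
Fact congr_le_trans : transitive congr_le.
Proof.
move=> u t v /asboolP tu /asboolP uv; apply/asboolP => a b tab.
by apply: uv; exact: tu.
Qed.

Fact congr_display : Order.disp_t. Proof. exact: Order.Disp tt tt. Qed.

HB.instance Definition _ := Order.Le_isPOrder.Build congr_display (congr A)
  congr_le_refl congr_le_anti congr_le_trans.

Lemma congr_leP t u : reflect (forall a b, t a b -> u a b) (t <= u)%O.
Proof. exact: asboolP. Qed.

Lemma le_Meet S t : (t <= Meet S)%O <-> forall u, S u -> (t <= u)%O.
Proof.
split=> [/congr_leP H u Su|H]; first by apply/congr_leP => a b /H; apply.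
by apply/congr_leP => a b tab u /H /congr_leP; apply.
Qed.

Lemma Join_le S t : (Join S <= t)%O <-> forall u, S u -> (u <= t)%O.
Proof.
split=> [/congr_leP H u Su|H].
  by apply/congr_leP => a b uab; apply: H => v /(_ u Su) /congr_leP; apply.
by apply/congr_leP => a b /(_ t); apply => u /H.
Qed.

Fact congr_meetP t u v :
  (t <= Meet [set u; v])%O = (t <= u)%O && (t <= v)%O.
Proof.
apply/idP/andP => [/le_Meet H|[tu tv]]; first by split; apply: H; [left|right].
by apply/le_Meet => w [->|->].
Qed.
Fact congr_joinP t u v :
  (Join [set t; u] <= v)%O = (t <= v)%O && (u <= v)%O.
Proof.
apply/idP/andP => [/Join_le H|[tv uv]]; first by split; apply: H; [left|right].
by apply/Join_le => w [->|->].
Qed.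

HB.instance Definition _ :=
  Order.POrder_MeetJoin_isLattice.Build congr_display (congr A)
    congr_meetP congr_joinP.

Fact Delta_le t : (Delta <= t)%O.
Proof. by apply/congr_leP => a b /= ->; exact: (congr_refl (congrP t) b). Qed.
Fact le_Nabla t : (t <= Nabla)%O.
Proof. exact/congr_leP. Qed.

HB.instance Definition _ :=
  Order.hasBottom.Build congr_display (congr A) Delta_le.
HB.instance Definition _ :=
  Order.hasTop.Build congr_display (congr A) le_Nabla.

Definition compact t :=
  forall S, (t <= Join S)%O ->
    exists F : set (congr A), [/\ F `<=` S, finite_set F & (t <= Join F)%O].

Definition regular_congruence t :=
  exists S, S `<=` [set u | complemented u] /\ t = Join S.

Lemma compact_bot : compact \bot%O.
Proof. by move=> S _; exists set0; split => //; exact: le0x. Qed.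

Lemma Join_sub S S' : S `<=` S' -> (Join S <= Join S')%O.
Proof. by move=> H; apply/Join_le => u /H; apply: (Join_le _ _).1. Qed.

Lemma compact_join t u : compact t -> compact u -> compact (t `|` u)%O.
Proof.
move=> ct cu S; rewrite leUx => /andP[/ct [F [FS finF tF]] /cu [G [GS finG uG]]].
exists (F `|` G); split; first by rewrite subUset.
  by rewrite finite_setU.
rewrite leUx; apply/andP; split.
  by apply: le_trans tF _; apply: Join_sub; exact: subsetUl.
by apply: le_trans uG _; apply: Join_sub; exact: subsetUr.
Qed.

End CongruenceLattice.

Definition congruence_modular (s : signature) (V : algebra s -> Prop) :=
  forall A : algebra s, V A -> modular (congr A).

Section Images.
Variables (s : signature) (A B : algebra s) (h : surj_hom A B).

Fact preim_congr_subproof (u : congr B) : is_congr (fun a b => u (h a) (h b)).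
Proof.
have [r sy tr o] := congrP u; split=> [a|a b|a b c|f x y H].
- exact: r.
- exact: sy.
- exact: tr.
- by rewrite !surj_is_hom; exact: o.
Qed.
Definition preim_congr (u : congr B) : congr A := Congr (preim_congr_subproof u).

Definition Ker : congr A := preim_congr \bot%O.

Lemma joinKerE (t : congr A) a a' b b' : h a = h a' -> h b = h b' ->
  (t `|` Ker)%O a b -> (t `|` Ker)%O a' b'.
Proof.
have [r sy tr _] := congrP (t `|` Ker)%O.
have K x y : h x = h y -> (t `|` Ker)%O x y.
  move=> xy; have /congr_leP : (Ker <= t `|` Ker)%O by exact: leUr.
  exact.
move=> aa bb H; apply: (tr _ b); last exact: K.
by apply: (tr _ a) => //; apply: K.
Qed.

Fact image_congr_subproof (t : congr A) :
  is_congr (fun x y => exists a b, [/\ h a = x, h b = y & (t `|` Ker)%O a b]).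
Proof.
have [r sy tr o] := congrP (t `|` Ker)%O; split.
- by move=> x; have [a ax] := surj_surj h x; exists a, a.
- by move=> x y [a [b [ax bX ab]]]; exists b, a; split => //; exact: sy.
- move=> x y z [a [b [ax bX ab]]] [b' [c [b'x cz bc]]]; exists a, c.
  split=> //; apply: tr ab _; apply: joinKerE bc => //.
  by rewrite b'x.
- move=> f x y /choice[a /choice[b H]].
  exists (op a), (op b); rewrite !surj_is_hom; split.
  + by congr op; apply/funext => i; have [] := H i.
  + by congr op; apply/funext => i; have [] := H i.
  + by apply: o => i; have [] := H i.
Qed.
(* The direct image h(t \/ Ker h): joining with the kernel is what makes the
   direct image a congruence. *)
Definition image_joinKer (t : congr A) : congr B :=
  Congr (image_congr_subproof t).

End Images.

Definition congr_op2 (s : signature) :=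
  forall A : algebra s, congr A -> congr A -> congr A.

Definition commutator_like (s : signature) (V : algebra s -> Prop)
    (C : congr_op2 s) :=
  (forall (A : algebra s) (t u : congr A), V A -> (C A t u <= t `&` u)%O) /\
  (forall (A B : algebra s) (h : surj_hom A B) (t u : congr A), V A -> V B ->
    (C A t u `|` Ker h)%O =
      preim_congr h (C B (image_joinKer h t) (image_joinKer h u))).

(* Only the values of C on members of V matter. *)
Definition is_commutator (s : signature) (V : algebra s -> Prop)
    (C : congr_op2 s) :=
  commutator_like V C /\
  forall C' : congr_op2 s, commutator_like V C' ->
    forall A : algebra s, V A -> forall t u : congr A, (C' A t u <= C A t u)%O.

Section Primes.
Variables (s : signature) (A : algebra s) (C : congr A -> congr A -> congr A).

Definition prime_congr (p : congr A) :=
  p <> \top%O /\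
  forall t u, (C t u <= p)%O -> (t <= p)%O \/ (u <= p)%O.

Definition rho (t : congr A) : congr A :=
  Meet [set p | prime_congr p /\ (t <= p)%O].

Definition semiprime := rho \bot%O = \bot%O.

Definition compact_closed :=
  forall t u, compact t -> compact u -> compact (C t u).

End Primes.

(* The hypotheses under which K(A)/== carries its bounded distributive lattice
   structure; they hold in the situation at hand by commutator_reticulable. *)
Record reticulable (s : signature) (A : algebra s)
    (C : congr A -> congr A -> congr A) : Prop := Reticulable {
  ret_le_meet : forall t u, (C t u <= t `&` u)%O;
  ret_top : compact (\top%O : congr A);
  ret_closed : compact_closed C }.

Record compact_congr (s : signature) (A : algebra s) := CompactCongr {
  compact_val : congr A;
  compact_valP : `[< compact compact_val >] }.

HB.instance Definition _ (s : signature) (A : algebra s) :=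
  [isSub for @compact_val s A].
HB.instance Definition _ (s : signature) (A : algebra s) :=
  [Choice of compact_congr A by <:].

Section Reticulation.
Variables (s : signature) (A : algebra s) (C : congr A -> congr A -> congr A).
Hypothesis h : reticulable C.
Implicit Types a b c : compact_congr A.

Lemma compactP a : compact (val a).
Proof. exact/asboolP/(valP a). Qed.
Arguments compactP : clear implicits.

Definition mkK t (ct : compact t) : compact_congr A :=
  CompactCongr (introT (asboolP _) ct).

Definition Kbot := mkK (@compact_bot s A).
Definition Ktop := mkK (ret_top h).
Definition Kjoin a b := mkK (compact_join (compactP a) (compactP b)).
Definition Kcomm a b := mkK (ret_closed h (compactP a) (compactP b)).

Definition ret_equiv a b : bool := rho C (val a) == rho C (val b).

Fact ret_equivP : equiv_class_of ret_equiv.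
Proof. by split=> [a|a b|b a c]; rewrite /ret_equiv // => /eqP->. Qed.
Canonical ret_equiv_rel := EquivRelPack ret_equivP.

Definition reticulation of reticulable C := {eq_quot ret_equiv}%qT.

Local Notation L := (reticulation h).

HB.instance Definition _ := Choice.on L.
HB.instance Definition _ := EqQuotient.on L.

Definition lam a : L := \pi_L%qT a.

Definition ret_meet (x y : L) : L := lam (Kcomm (repr x) (repr y)).
Definition ret_join (x y : L) : L := lam (Kjoin (repr x) (repr y)).
Definition ret_le (x y : L) : bool := ret_meet x y == x.
Definition ret_lt (x y : L) : bool := (y != x) && ret_le x y.

(* The primes above a; two compact congruences are identified exactly when
   these sets agree. *)
Let above (t : congr A) : set (congr A) :=
  [set p | prime_congr C p /\ (t <= p)%O].

Lemma lamP a b : lam a = lam b <-> above (val a) = above (val b).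
Proof.
have -> : lam a = lam b <-> rho C (val a) = rho C (val b).
  by split=> [/eqP|H]; [|apply/eqP]; rewrite /lam eqmodE /= /ret_equiv ?H // => /eqP.
split=> [E|E]; last by rewrite /rho; congr Meet.
have sub t u : rho C t = rho C u -> above u `<=` above t.
  move=> e p [pp up]; split=> //.
  apply: (@le_trans _ _ (rho C t)); first by apply/le_Meet => q [].
  by rewrite e; apply/congr_leP => x y; apply.
by apply/seteqP; split; apply: sub.
Qed.

Let V (x : L) := above (val (repr x)).

Lemma Vinj : injective V.
Proof. by move=> x y /lamP; rewrite /lam !reprK. Qed.

Lemma Vlam a : V (lam a) = above (val a).
Proof. by apply/lamP; rewrite /lam reprK. Qed.

Lemma above_join t u : above (t `|` u)%O = above t `&` above u.
Proof.
apply/seteqP; split=> p /=; first by rewrite /above /= leUx => -[pp /andP[]].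
by move=> [[pp tp] [_ up]]; rewrite /above /= leUx tp up.
Qed.

Lemma above_comm t u : above (C t u) = above t `|` above u.
Proof.
apply/seteqP; split=> p /=.
  by move=> [pp /(pp.2 _ _)[|]]; [left|right].
have := ret_le_meet h t u; rewrite lexI => /andP[Ct Cu].
by move=> [] [pp H]; split=> //; [exact: le_trans Ct H|exact: le_trans Cu H].
Qed.

Lemma Vmeet x y : V (ret_meet x y) = V x `|` V y.
Proof. by rewrite /ret_meet Vlam /= above_comm. Qed.
Lemma Vjoin x y : V (ret_join x y) = V x `&` V y.
Proof. by rewrite /ret_join Vlam /= above_join. Qed.

Fact ret_meetC : commutative ret_meet.
Proof. by move=> x y; apply: Vinj; rewrite !Vmeet setUC. Qed.
Fact ret_joinC : commutative ret_join.
Proof. by move=> x y; apply: Vinj; rewrite !Vjoin setIC. Qed.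
Fact ret_meetA : associative ret_meet.
Proof. by move=> x y z; apply: Vinj; rewrite !Vmeet setUA. Qed.
Fact ret_joinA : associative ret_join.
Proof. by move=> x y z; apply: Vinj; rewrite !Vjoin setIA. Qed.
Fact ret_joinKI y x : ret_meet x (ret_join x y) = x.
Proof. by apply: Vinj; rewrite Vmeet Vjoin; apply/setUidPl; exact: subIsetl. Qed.
Fact ret_meetKU y x : ret_join x (ret_meet x y) = x.
Proof. by apply: Vinj; rewrite Vjoin Vmeet; apply/setIidPl; exact: subsetUl. Qed.
Fact ret_meetUl : left_distributive ret_meet ret_join.
Proof. by move=> x y z; apply: Vinj; rewrite !(Vmeet, Vjoin) setUIl. Qed.
Fact ret_meetxx : idempotent_op ret_meet.
Proof. by move=> x; apply: Vinj; rewrite Vmeet setUid. Qed.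

Fact ret_display : Order.disp_t. Proof. exact: Order.Disp tt tt. Qed.

HB.instance Definition _ := Order.isMeetJoinDistrLattice.Build ret_display L
  (fun _ _ => erefl : ret_le _ _ = _) (fun _ _ => erefl : ret_lt _ _ = _)
  ret_meetC ret_joinC ret_meetA ret_joinA ret_joinKI ret_meetKU ret_meetUl
  ret_meetxx.

Lemma lam_join a b : (lam a `|` lam b)%O = lam (Kjoin a b).
Proof. by apply: Vinj; rewrite Vjoin !Vlam /= above_join. Qed.
Lemma lam_meet a b : (lam a `&` lam b)%O = lam (Kcomm a b).
Proof. by apply: Vinj; rewrite Vmeet !Vlam /= above_comm. Qed.

Fact ret_le0 (x : L) : (lam Kbot <= x)%O.
Proof.
apply/eqP/Vinj; rewrite Vmeet Vlam; apply/setUidPl => p [pp _].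
by split=> //; exact: le0x.
Qed.
Fact ret_le1 (x : L) : (x <= lam Ktop)%O.
Proof.
apply/eqP/Vinj; rewrite Vmeet Vlam; apply/setUidPl => p [pp] /=.
by rewrite le1x => /eqP /(pp.1).
Qed.

HB.instance Definition _ := Order.hasBottom.Build ret_display L ret_le0.
HB.instance Definition _ := Order.hasTop.Build ret_display L ret_le1.

Definition star (t : congr A) : set L :=
  [set lam a | a in [set a | (val a <= t)%O]].

Definition costar (I : set L) : congr A :=
  Join [set val a | a in [set a | I (lam a)]].

End Reticulation.
Arguments star {s A C} h t.
Arguments costar {s A C h} I.
Arguments lam {s A C} h a.

Section Quotient.
Variables (s : signature) (A : algebra s) (t : congr A).

Definition quot_type := {X : A -> Prop | exists a, X = t a}.

Definition quot_pi (a : A) : quot_type := exist _ (t a) (ex_intro _ a erefl).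

Lemma quot_repr (x : quot_type) : exists a, quot_pi a = x.
Proof.
by case: x => X [a aX]; exists a; apply: eq_exist; rewrite aX.
Qed.

Lemma quot_piP a b : quot_pi a = quot_pi b <-> t a b.
Proof.
have [r sy tr _] := congrP t; split=> [[->]|ab]; first exact: r.
apply: eq_exist; apply/funext => c; apply/propext.
by split; [exact/tr/sy|exact: tr].
Qed.

Definition quot_op (f : symbol s) (x : 'I_(arity f) -> quot_type) : quot_type :=
  quot_pi (op (fun i => sval (cid (quot_repr (x i))))).

Definition quot_algebra : algebra s :=
  @Algebra s quot_type quot_op
    (let: inhabits a := carrier_inhabited A in inhabits (quot_pi a)).

Lemma quot_pi_hom : @is_hom s A quot_algebra quot_pi.
Proof.
move=> f x; apply/quot_piP; apply: (congr_op (congrP t)) => i.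
by apply/quot_piP; case: cid => /= a ->.
Qed.

Definition quot_surj : surj_hom A quot_algebra :=
  @SurjHom s A quot_algebra quot_pi quot_pi_hom quot_repr.

End Quotient.

Lemma Join_finite (s : signature) (A : algebra s) (S : set (congr A)) a b :
  Join S a b ->
  exists F : set (congr A), [/\ F `<=` S, finite_set F & Join F a b].
Proof.
pose R a b :=
  exists F : set (congr A), [/\ F `<=` S, finite_set F & Join F a b].
have R_congr : is_congr R.
  split.
  - by move=> x; exists set0; split => //; exact: (congr_refl (congrP _) x).
  - move=> x y [F [FS fF xy]]; exists F; split => //.
    exact: (congr_sym (congrP _) xy).
  - move=> x y z [F [FS fF xy]] [G [GS fG yz]]; exists (F `|` G).
    split; [by rewrite subUset|by rewrite finite_setU|].
    apply: (congr_trans (congrP _) (b := y)).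
      have /congr_leP : (Join F <= Join (F `|` G))%O by exact/Join_sub/subsetUl.
      exact.
    have /congr_leP : (Join G <= Join (F `|` G))%O by exact/Join_sub/subsetUr.
    exact.
  - move=> f x y /choice[F H]; exists (\bigcup_i F i); split.
    + by move=> u [i _ Fu]; have [+ _ _] := H i; apply.
    + apply: bigcup_finite; first exact: finite_finset.
      by move=> i _; have [] := H i.
    + apply: (congr_op (congrP _)) => i; have [_ _ Fi] := H i.
      have /congr_leP : (Join (F i) <= Join (\bigcup_i F i))%O.
        by apply: Join_sub; exact: bigcup_sup.
      exact.
suff /congr_leP : (Join S <= Congr R_congr)%O by apply.
apply/Join_le => u Su; apply/congr_leP => x y uxy; exists [set u].
split=> [v ->//||]; first exact: finite_set1.
have /congr_leP : (u <= Join [set u])%O by apply: (Join_le _ _).1.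
exact.
Qed.

Lemma semidegenerate_compact (s : signature) (V : algebra s -> Prop)
    (A : algebra s) :
  variety V -> semidegenerate V -> V A -> compact (\top%O : congr A).
Proof.
move=> hV sd VA S /congr_leP topS; have [a] := carrier_inhabited A.
have /choice[F H] (f : symbol s) : exists F : set (congr A),
    [/\ F `<=` S, finite_set F & Join F (op (fun _ : 'I_(arity f) => a)) a].
  by apply: Join_finite; exact: topS.
exists (\bigcup_f F f); split.
- by move=> u [f _ Fu]; have [+ _ _] := H f; apply.
- apply: bigcup_finite; first exact: finite_finset.
  by move=> f _; have [] := H f.
set J := Join _; pose Q := quot_algebra J.
have VQ : V Q by exact: (variety_image hV (quot_surj J) VA).
apply/congr_leP => x y _; apply/quot_piP; apply/not_notP => xy.
apply: (sd Q VQ); first by exists (quot_pi J x), (quot_pi J y).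
exists (quot_pi J a); split; first by exists (quot_pi J a).
move=> f z za; have -> : z = (fun=> quot_pi J a) by apply/funext.
have /= <- := quot_pi_hom J (fun _ : 'I_(arity f) => a).
apply/quot_piP; have [_ _ Ff] := H f.
have /congr_leP : (Join (F f) <= J)%O by apply: Join_sub; exact: bigcup_sup.
exact.
Qed.

Lemma commutator_reticulable (s : signature) (V : algebra s -> Prop)
    (C : congr_op2 s) (A : algebra s) :
  variety V -> semidegenerate V -> is_commutator V C -> V A ->
  compact_closed (C A) -> reticulable (C A).
Proof.
move=> hV sd [[HC _] _] VA cA; split=> //; first by move=> t u; exact: HC.
exact: (semidegenerate_compact hV sd VA).
Qed.

(* Main.v *)
Require Import Defs.
Set Warnings "-notation-overridden".
From mathcomp Require Import all_boot all_order.
From mathcomp Require Import boolp classical_sets cardinality.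

(** Write L for the reticulation and lam for the projection onto it.

    For (1), Con A is a modular algebraic lattice with compact top.  If
    t and v are complements, compactness of the top yields a compact k <= t
    that still joins v to the top, and modularity forces k = t: complemented
    congruences are compact ([complemented_compact]).  The meet of lam t and
    lam v is lam [t, v] with [t, v] <= t /\ v = 0, so lam maps complemented
    congruences to complemented elements.  When theta is a join of
    complemented congruences, a compact congruence below theta is below a
    finite join of them, hence theta^* is generated by their images.

    For (2), let A be semiprime and let lam a, lam b be complements in L.
    Every prime contains [a, b], hence a or b, hence a /\ b, so a /\ b = 0.  No
    prime contains a \/ b, so a \/ b is the top as soon as every proper
    congruence is contained in a prime.  Thus lam also reflects complemented
    elements ([complemented_of_lam]).  Moreover rho k = k for a complemented k
    ([complemented_rho]), so lam a <= lam k gives a <= k; applied to the finite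
    joins k of generators of I this identifies I_* with a join of complemented
    congruences.

    The substantial point is that proper congruences lie in primes.  By Zorn
    they lie in maximal ones, and a maximal p is prime unless
    [Nabla, Nabla] = Delta in the nontrivial algebra A/p.  Since the commutator
    is only known as the greatest operation with two formal properties, a lower
    bound for it has to come from an operation that has these properties.
    Such an operation is built from the congruence Delta2 u t of Hagemann and
    Herrmann on the pairs (a, b) with a u b, generated by the pairs of
    diagonal elements (x, x), (y, y) with x t y: call t central over u modulo d
    when Delta2 u t does not lead from a pair in d to a pair outside d, and
    take the least such d.  Modularity of the congruence lattice of the algebra
    of pairs shows that centrality passes to larger d ([central_up]), is
    symmetric in t and u ([central_sym]), and is insensitive to joining t and u
    with congruences below d ([central_join]); this gives the required
    properties ([centralizer_commutator_like]).  If Nabla were central over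
    Nabla modulo Delta in B, the diagonal would be a single class of a
    congruence on B x B and a subuniverse, so the quotient would have a
    one-element subalgebra; semidegeneracy makes it trivial, and then B is
    trivial ([nabla_not_central]). *)

Set Implicit Arguments.
Unset Strict Implicit.
Unset Printing Implicit Defensive.

Import Order.TTheory.
Local Open Scope classical_set_scope.

(** * Congruences as relations *)

Section CongruenceRelations.
Variables (s : signature) (A : algebra s).
Implicit Types (t u v : congr A) (S : set (congr A)).

Lemma congrR t a : t a a.
Proof. exact: (congr_refl (congrP t)). Qed.

Lemma congrS t a b : t a b -> t b a.
Proof. exact: (congr_sym (congrP t)). Qed.

Lemma congrT t b a c : t a b -> t b c -> t a c.
Proof. exact: (congr_trans (congrP t)). Qed.

Lemma congr_leE t u : (t <= u)%O -> forall a b, t a b -> u a b.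
Proof. by move/congr_leP. Qed.

Lemma congr_meetE t u a b : (t `&` u)%O a b <-> t a b /\ u a b.
Proof.
split=> [H|[ta ua]]; last by have : Meet [set t; u] a b by move=> v [->|->].
by split; [exact: (congr_leE (leIl _ _)) H|exact: (congr_leE (leIr _ _)) H].
Qed.

Lemma le_Join S t : S t -> (t <= Join S)%O.
Proof. by move=> St; apply: (Join_le S _).1. Qed.

Lemma Meet_le S t : S t -> (Meet S <= t)%O.
Proof. by move=> St; apply: (le_Meet S _).1. Qed.

Definition compatible (R : A -> A -> Prop) :=
  forall (f : symbol s) (x y : 'I_(arity f) -> A),
    (forall i, R (x i) (y i)) -> R (op x) (op y).

Fixpoint chain (R : A -> A -> Prop) n (a b : A) : Prop :=
  if n is m.+1 then exists2 c, R a c & chain R m c b else a = b.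

Lemma chain_cat R m n a b c : chain R m a b -> chain R n b c -> chain R (m + n) a c.
Proof.
elim: m a => [|m IH] a /=; first by move=> ->.
by case=> d ad db bc; exists d => //; exact: IH.
Qed.

Lemma chain_sub R (E : A -> A -> Prop) n a b :
  (forall c, E c c) -> (forall c d e, E c d -> E d e -> E c e) ->
  (forall c d, R c d -> E c d) -> chain R n a b -> E a b.
Proof.
move=> Er Et RE; elim: n a => [|n IH] a /=; first by move=> ->.
by case=> d /RE ad /IH; exact: Et.
Qed.

Section TransitiveClosure.
Variable R : A -> A -> Prop.
Hypotheses (R_refl : forall a, R a a) (R_sym : forall a b, R a b -> R b a)
  (R_op : compatible R).

Lemma chain_widen m n a b : m <= n -> chain R m a b -> chain R n a b.
Proof.
move=> /subnK <- ab; apply: chain_cat ab.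
by elim: (n - m) => //= k IH; exists a.
Qed.

Lemma chain_op n (f : symbol s) (x y : 'I_(arity f) -> A) :
  (forall i, chain R n (x i) (y i)) -> chain R n (op x) (op y).
Proof.
elim: n x => [|n IH] x /= H; first by congr op; apply/funext.
have /choice[z zP] i : exists z, R (x i) z /\ chain R n z (y i).
  by have [z] := H i; exists z.
by exists (op z); [apply: R_op => i|apply: IH => i]; have [] := zP i.
Qed.

(** Compatibility holds because finitely many chains, one for each argument,
    can be padded by reflexivity to a common length. *)
Fact closure_subproof : is_congr (fun a b => exists n, chain R n a b).
Proof.
split.
- by move=> a; exists 0.
- move=> a b [n]; elim: n a => [|n IH] a /=; first by move=> ->; exists 0.
  case=> c ac /IH [m bc]; exists (m + 1).
  by apply: chain_cat bc _; exists a => //; exact: R_sym.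
- by move=> a b c [m ab] [n bc]; exists (m + n); exact: chain_cat bc.
- move=> f x y /choice[n H]; exists (\max_i n i); apply: chain_op => i.
  by apply: chain_widen (H i); exact: leq_bigmax.
Qed.
Definition closure : congr A := Congr closure_subproof.

Lemma sub_closure a b : R a b -> closure a b.
Proof. by move=> ab; exists 1; exists b. Qed.

Lemma closure_sub (E : A -> A -> Prop) a b :
  (forall c, E c c) -> (forall c d e, E c d -> E d e -> E c e) ->
  (forall c d, R c d -> E c d) -> closure a b -> E a b.
Proof. by move=> Er Et RE [n]; exact: chain_sub. Qed.

End TransitiveClosure.

(** The join of two congruences is the transitive closure of their
    composites, so it lies in every preorder containing both. *)
Lemma join_sub t u (E : A -> A -> Prop) :
  (forall c d e, E c d -> E d e -> E c e) ->
  (forall c d, t c d -> E c d) -> (forall c d, u c d -> E c d) ->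
  forall a b, (t `|` u)%O a b -> E a b.
Proof.
move=> Et tE uE a b.
pose R a b := exists c d, [/\ t a c, u c d & t d b].
have Rr c : R c c by exists c, c; split; exact: congrR.
have Rs c d : R c d -> R d c.
  by move=> [x [y [cx xy yd]]]; exists y, x; split; exact: congrS.
have Ro : compatible R.
  move=> f x y /choice[c /choice[d H]]; exists (op c), (op d).
  by split; apply: (congr_op (congrP _)) => i; have [] := H i.
have tR : (t <= closure Rr Rs Ro)%O.
  apply/congr_leP => c d cd; apply: sub_closure.
  by exists c, c; split=> //; exact: congrR.
have uR : (u <= closure Rr Rs Ro)%O.
  apply/congr_leP => c d cd; apply: sub_closure.
  by exists c, d; split=> //; exact: congrR.
have : (t `|` u <= closure Rr Rs Ro)%O by rewrite leUx tR.
move=> /congr_leE H /H; apply: closure_sub => //.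
  by move=> c; apply: tE; exact: congrR.
move=> c d [x [y [cx xy yd]]].
exact: (Et _ _ _ (tE _ _ cx) (Et _ _ _ (uE _ _ xy) (tE _ _ yd))).
Qed.

Lemma finite_Join_ind (P : congr A -> Prop) (F : set (congr A)) :
  P \bot%O -> (forall t u, P t -> P u -> P (t `|` u)%O) ->
  finite_set F -> F `<=` P -> P (Join F).
Proof.
move=> P0 PU /finite_seqP[l ->]; elim: l => [|t l IH] lP.
  suff -> : Join [set` [::]] = \bot%O :> congr A by [].
  by apply/eqP; rewrite -lex0; apply/Join_le => u.
have -> : Join [set` t :: l] = (t `|` Join [set` l])%O.
  apply/le_anti/andP; split; last first.
    rewrite leUx; apply/andP; split; first by apply: le_Join; exact: mem_head.
    by apply: Join_sub => u /= ul; rewrite inE ul orbT.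
  apply/Join_le => u /=; rewrite inE => /predU1P[->|ul]; first exact: leUl.
  by apply: le_trans (leUr _ _); exact: le_Join.
apply: PU; first by apply: lP; rewrite /= mem_head.
by apply: IH => u ul; apply: lP; rewrite /= inE ul orbT.
Qed.

End CongruenceRelations.

(** Preimages along homomorphisms that need not be surjective, such as the
    projections and the diagonal of an algebra of pairs. *)
Section Pullback.
Variables (s : signature) (A B : algebra s) (h : A -> B).
Hypothesis h_hom : is_hom h.

Fact pullback_subproof (u : congr B) : is_congr (fun a b => u (h a) (h b)).
Proof.
split=> [a|a b|a b c|f x y H]; first exact: congrR.
- exact: congrS.
- exact: congrT.
- by rewrite !h_hom; exact: (congr_op (congrP u)).
Qed.
Definition pullback (u : congr B) : congr A := Congr (pullback_subproof u).

End Pullback.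

(** * The subalgebra of the square given by a congruence *)

Section PairAlgebra.
Variables (s : signature) (A : algebra s) (u : congr A).

Definition pair_type := {p : A * A | u p.1 p.2}.

Definition mk_pair a b (ab : u a b) : pair_type := exist _ (a, b) ab.

Fact pair_inhabited : inhabited pair_type.
Proof. by have [a] := carrier_inhabited A; constructor; exact: mk_pair (congrR u a). Qed.

Definition pair_op (f : symbol s) (x : 'I_(arity f) -> pair_type) : pair_type :=
  mk_pair (congr_op (congrP u) (fun i => svalP (x i))).

Definition pair_algebra : algebra s := @Algebra s pair_type pair_op pair_inhabited.

Definition fst_of (p : pair_algebra) : A := (sval p).1.
Definition snd_of (p : pair_algebra) : A := (sval p).2.
Definition diag (a : A) : pair_algebra := mk_pair (congrR u a).

Lemma fst_hom : is_hom fst_of. Proof. by []. Qed.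
Lemma snd_hom : is_hom snd_of. Proof. by []. Qed.

Lemma pair_ext (p q : pair_algebra) :
  fst_of p = fst_of q -> snd_of p = snd_of q -> p = q.
Proof.
case: p q => [[a b] ab] [[c d] cd]; rewrite /fst_of /snd_of /= => ac bd.
by apply: eq_exist; rewrite ac bd.
Qed.

Lemma diag_hom : is_hom diag.
Proof. by move=> f x; exact: pair_ext. Qed.

Lemma pair_rel (p : pair_algebra) : u (fst_of p) (snd_of p).
Proof. exact: (svalP p). Qed.

(** The algebra of pairs embeds in the square, so it inherits modularity of
    its congruence lattice from the variety. *)
Lemma pair_variety (V : algebra s -> Prop) : variety V -> V A -> V pair_algebra.
Proof.
move=> hV VA.
apply: (variety_sub hV
  (h := fun p : pair_algebra => (fun b => if b then fst_of p else snd_of p)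
        : prod_algebra (fun _ : bool => A))); last exact: variety_prod.
  by move=> f x; apply/funext => -[].
by move=> p q /= E; apply: pair_ext;
  [have := congr1 (@^~ true) E|have := congr1 (@^~ false) E].
Qed.

Definition ker1 : congr pair_algebra := pullback fst_hom \bot%O.
Definition ker2 : congr pair_algebra := pullback snd_hom \bot%O.

Lemma ker12 (t : congr pair_algebra) : (ker1 `&` ker2 <= t)%O.
Proof.
apply/congr_leP => p q /congr_meetE[/= p1 p2].
by rewrite (pair_ext p1 p2); exact: congrR.
Qed.

(** In other notation, the congruence Delta_(t,u) of Hagemann and Herrmann:
    pairs are read as rows with u between columns, and t relates rows. *)
Definition Delta2 (t : congr A) : congr pair_algebra :=
  Meet [set T | forall x y, t x y -> T (diag x) (diag y)].

Lemma Delta2_diag (t : congr A) x y : t x y -> Delta2 t (diag x) (diag y).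
Proof. by move=> xy T; exact. Qed.

Lemma Delta2_le (t : congr A) (T : congr pair_algebra) :
  (forall x y, t x y -> T (diag x) (diag y)) -> (Delta2 t <= T)%O.
Proof. by move=> H; exact: Meet_le. Qed.

Lemma Delta2_fst (t : congr A) p q : Delta2 t p q -> t (fst_of p) (fst_of q).
Proof. by apply: (congr_leE (u := pullback fst_hom t)); exact: Delta2_le. Qed.

Lemma Delta2_snd (t : congr A) p q : Delta2 t p q -> t (snd_of p) (snd_of q).
Proof. by apply: (congr_leE (u := pullback snd_hom t)); exact: Delta2_le. Qed.

Definition preserves (T : congr pair_algebra) (d : congr A) :=
  forall p q, T p q -> d (fst_of p) (snd_of p) -> d (fst_of q) (snd_of q).

End PairAlgebra.

Arguments fst_of {s A u} p.
Arguments snd_of {s A u} p.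
Arguments diag {s A} u a.
Arguments Delta2 {s A} u t.
Arguments Delta2_diag {s A} u {t x y}.

(** * Centrality *)

(** Since [Delta2] is the transitive closure of the (t, u)-matrices, this is the
    term condition: t centralizes u modulo d. *)
Definition central (s : signature) (A : algebra s) (t u d : congr A) :=
  preserves (Delta2 u t) d.

(** Gumm's shifting lemma: in a rectangle with sides in alpha and beta, the
    congruence gamma moves from one alpha-side to the other.  The pair (r, r')
    lies in alpha /\ (beta \/ (alpha /\ gamma)), to which the modular law
    applies. *)
Lemma modular_shift (s : signature) (X : algebra s) (alpha beta gamma : congr X) :
  modular (congr X) -> (alpha `&` beta <= gamma)%O ->
  forall p q r r', alpha p q -> alpha r r' -> beta p r -> beta q r' ->
    gamma p q -> gamma r r'.
Proof.
move=> mod abc p q r r' apq arr bpr bqr gpq.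
suff : ((alpha `&` gamma) `|` (beta `&` alpha))%O r r'.
  by apply: congr_leE; rewrite leUx leIr /= meetC.
rewrite mod ?leIl //; apply/congr_meetE; split=> //.
set J := (_ `|` _)%O.
have bJ : forall x y, beta x y -> J x y by apply: congr_leE; exact: leUr.
have agJ : forall x y, (alpha `&` gamma)%O x y -> J x y.
  by apply: congr_leE; exact: leUl.
apply: (congrT (b := p)); first by apply: congrS; exact: bJ.
apply: (congrT (b := q)); last exact: bJ.
by apply: agJ; apply/congr_meetE.
Qed.

Section Centrality.
Variables (s : signature) (V : algebra s -> Prop).
Hypotheses (V_variety : variety V) (V_modular : congruence_modular V).

Section OneAlgebra.
Variables (A : algebra s).
Hypothesis VA : V A.
Implicit Types (t u k d : congr A).

Let pair_modular u : modular (congr (pair_algebra u)).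
Proof. exact: V_modular (pair_variety u V_variety VA). Qed.

(** Shifting along the rectangle (a, b), (a, d), (b, b), (b, d), whose sides are
    in the kernels of the projections, turns a T-step with fixed first
    coordinate into one that starts on the diagonal. *)
Lemma preserves_ker1 u d (T : congr (pair_algebra u)) p q :
  preserves T d -> T p q -> fst_of p = fst_of q -> d (snd_of p) (snd_of q).
Proof.
move=> Td Tpq pq1.
have ubb : u (snd_of p) (snd_of q).
  apply: (congrT (b := fst_of p)); first exact/congrS/pair_rel.
  by rewrite pq1; exact: pair_rel.
apply: (Td (diag u (snd_of p)) (mk_pair ubb)); last exact: congrR.
exact: (modular_shift (@pair_modular u) (ker12 T) (p := p) (q := q)).
Qed.

Lemma central_of u t d (T : congr (pair_algebra u)) :
  (forall x y, t x y -> T (diag u x) (diag u y)) -> preserves T d ->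
  central t u d.
Proof. by move=> tT Td p q /(congr_leE (Delta2_le tT)); exact: Td. Qed.

(** By [preserves_ker1], centrality modulo d says that Delta2-steps with fixed
    first coordinate move the second one inside d.  This form is
    monotone in d, and the shifting lemma on the rectangle (a, a), (a, b),
    (c, c), (c, e) recovers preservation of the larger congruence from it. *)
Lemma central_up t u d d' : central t u d -> (d <= d')%O -> central t u d'.
Proof.
move=> cd dd' p q Dpq.
have t1 := Delta2_fst Dpq.
apply: (modular_shift (alpha := ker1 u) (beta := Delta2 u t)
  (gamma := pullback (snd_hom (u := u)) d') (@pair_modular u) _
  (p := diag u (fst_of p)) (r := diag u (fst_of q)) (q := p) (r' := q)) => //.
  apply/congr_leP => x y /congr_meetE[/= xy1 xy].
  by apply: congr_leE dd' _ _ _; exact: preserves_ker1 cd xy xy1.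
exact: Delta2_diag.
Qed.

Lemma central_Meet t u (S : set (congr A)) :
  (forall d, S d -> central t u d) -> central t u (Meet S).
Proof. by move=> H p q Dpq dp d Sd; apply: (H d Sd) Dpq _; exact: dp. Qed.

Lemma central_meet t u : central t u (t `&` u)%O.
Proof.
move=> p q Dpq /congr_meetE[tp _]; apply/congr_meetE.
split; last exact: pair_rel.
apply: (congrT (b := fst_of p)); first exact/congrS/Delta2_fst.
by apply: congrT tp _; exact: Delta2_snd.
Qed.

Definition pullback2 u d : congr (pair_algebra u) :=
  (pullback (fst_hom (u := u)) d `&` pullback (snd_hom (u := u)) d)%O.

Lemma preserves_pullback2 u k d : (k <= d)%O -> preserves (pullback2 u k) d.
Proof.
move=> kd p q /congr_meetE[/= /(congr_leE kd) k1 /(congr_leE kd) k2] dp.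
by apply: congrT (congrS k1) _; exact: congrT k2.
Qed.

Lemma preserves_join u d (T T' : congr (pair_algebra u)) :
  preserves T d -> preserves T' d -> preserves (T `|` T')%O d.
Proof.
move=> Td Td'; apply: join_sub => //.
by move=> p q r pq qr dp; apply: qr; exact: pq.
Qed.

(** The congruence k acting on both coordinates preserves d, so it can be added
    to Delta2; the elements x, y whose diagonal pairs are then related form a
    congruence containing both t and k. *)
Lemma central_joinl t u k d : central t u d -> (k <= d)%O ->
  central (t `|` k)%O u d.
Proof.
move=> cd kd.
pose T := (Delta2 u t `|` pullback2 u k)%O.
apply: (@central_of _ _ _ T); last first.
  by apply: preserves_join => //; exact: preserves_pullback2.
suff : (t `|` k <= pullback (diag_hom u) T)%O by move/congr_leP.
rewrite leUx; apply/andP; split; apply/congr_leP => x y xy /=.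
  by apply: (congr_leE (leUl _ _)); exact: Delta2_diag.
by apply: (congr_leE (leUr _ _)); apply/congr_meetE.
Qed.

(** Rows may be exchanged with columns for the following reason.  Write k for the
    congruence d acting on both coordinates.  Passing through the diagonal,
    pairs whose first coordinates are in d are related by k \/ ker1, and the
    modular law gives T /\ (k \/ ker1) = k \/ (T /\ ker1), which is k by
    [preserves_ker1]. *)
Lemma preserves_transpose u d (T : congr (pair_algebra u)) p q :
  (pullback2 u d <= T)%O -> preserves T d -> T p q ->
  d (fst_of p) (fst_of q) -> d (snd_of p) (snd_of q).
Proof.
move=> kT Td Tpq d1.
suff : pullback2 u d p q by case/congr_meetE.
have le1 : (ker1 u `&` T <= pullback2 u d)%O.
  apply/congr_leP => x y /congr_meetE[/= xy1 xy]; apply/congr_meetE; split=> /=.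
    by rewrite xy1; exact: congrR.
  exact: preserves_ker1 Td xy xy1.
suff : (pullback2 u d `|` (ker1 u `&` T))%O p q.
  by apply: congr_leE; rewrite leUx lexx le1.
rewrite pair_modular //; apply/congr_meetE; split=> //.
set J := (_ `|` _)%O.
have kJ : forall x y, ker1 u x y -> J x y by apply: congr_leE; exact: leUr.
apply: (congrT (b := diag u (fst_of p))); first exact: kJ.
apply: (congrT (b := diag u (fst_of q))); last exact: kJ.
by apply: (congr_leE (leUl _ _)); apply/congr_meetE.
Qed.

(** The transposed matrices of Delta2 u t form a reflexive, symmetric and
    compatible relation on the pairs in t; its transitive closure contains
    Delta2 t u and preserves d by [preserves_transpose]. *)
Lemma central_sym t u d : central t u d -> central u t d.
Proof.
move=> cd.
pose T := (Delta2 u t `|` pullback2 u d)%O.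
have Td : preserves T d.
  by apply: preserves_join => //; exact: preserves_pullback2.
have DT : forall x y, Delta2 u t x y -> T x y by apply: congr_leE; exact: leUl.
(* Each matrix is required together with its mirror image, which makes the
   transposed relation symmetric. *)
pose R (p q : pair_algebra t) := exists (ab : u (fst_of p) (fst_of q))
  (cd : u (snd_of p) (snd_of q)),
  T (mk_pair ab) (mk_pair cd) /\ T (mk_pair (congrS ab)) (mk_pair (congrS cd)).
have Rr p : R p p.
  exists (congrR u _), (congrR u _).
  by split; apply: DT; have := Delta2_diag u (pair_rel p);
    congr (Delta2 u t _ _); exact: pair_ext.
have Rs p q : R p q -> R q p.
  move=> [ab [cd' [H H']]]; exists (congrS ab), (congrS cd'); split=> //.
  by move: H; congr (T _ _); exact: pair_ext.
have Ro : compatible R.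
  move=> f x y H.
  have ab i : u (fst_of (x i)) (fst_of (y i)) by have [] := H i.
  have cd' i : u (snd_of (x i)) (snd_of (y i)) by have [? []] := H i.
  exists (congr_op (congrP u) ab), (congr_op (congrP u) cd'); split.
    have : T (op (fun i => mk_pair (ab i) : pair_algebra u))
             (op (fun i => mk_pair (cd' i) : pair_algebra u)).
      apply: (congr_op (congrP T)) => i; have [ab0 [cd0 [+ _]]] := H i.
      by congr (T _ _); exact: pair_ext.
    by congr (T _ _); exact: pair_ext.
  have : T (op (fun i => mk_pair (congrS (ab i)) : pair_algebra u))
           (op (fun i => mk_pair (congrS (cd' i)) : pair_algebra u)).
    apply: (congr_op (congrP T)) => i; have [ab0 [cd0 [_ +]]] := H i.
    by congr (T _ _); exact: pair_ext.
  by congr (T _ _); exact: pair_ext.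
apply: (@central_of _ _ _ (closure Rr Rs Ro)).
  move=> x y xy; apply: sub_closure; exists xy, xy.
  by split; exact: congrR.
pose E (p q : pair_algebra t) :=
  d (fst_of p) (snd_of p) -> d (fst_of q) (snd_of q).
move=> p q pq; have : E p q; last exact.
apply: (closure_sub (E := E)) pq => [a|a b c|a b].
- by rewrite /E.
- by rewrite /E => ab bc /ab.
- by move=> [ab [cd' [H _]]]; exact: (preserves_transpose (leUr _ _) Td H).
Qed.

Lemma central_join t u k d : central t u d -> (k <= d)%O ->
  central (t `|` k)%O (u `|` k)%O d.
Proof.
move=> cd kd; apply: central_joinl => //; apply: central_sym.
by apply: central_joinl => //; exact: central_sym.
Qed.

Lemma centralS t t' u u' d : (t <= t')%O -> (u <= u')%O ->
  central t' u' d -> central t u d.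
Proof.
move=> tt' uu' cd.
pose i (p : pair_algebra u) : pair_algebra u' := mk_pair (congr_leE uu' (pair_rel p)).
have i_hom : is_hom i by move=> f x; exact: pair_ext.
apply: (@central_of _ _ _ (pullback i_hom (Delta2 u' t'))).
  move=> x y /(congr_leE tt') /(Delta2_diag u') /=.
  by congr (Delta2 u' t' _ _); exact: pair_ext.
by move=> p q /cd.
Qed.

End OneAlgebra.

Section Surjection.
Variables (A B : algebra s) (h : surj_hom A B).
Hypotheses (VA : V A) (VB : V B).
Implicit Types (t u d : congr A) (e : congr B).

Lemma image_joinKerE t a b : (t `|` Ker h)%O a b -> image_joinKer h t (h a) (h b).
Proof. by move=> ab; exists a, b. Qed.

Fact pair_map_subproof u (p : pair_algebra (u `|` Ker h)%O) :
  image_joinKer h u (h (fst_of p)) (h (snd_of p)).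
Proof. exact/image_joinKerE/pair_rel. Qed.

(** The pairs must be taken in u \/ Ker h for this map to be surjective. *)
Definition pair_map u (p : pair_algebra (u `|` Ker h)%O) :
  pair_algebra (image_joinKer h u) := mk_pair (pair_map_subproof p).

Lemma pair_map_hom u : is_hom (@pair_map u).
Proof. by move=> f x; apply: pair_ext; rewrite /= /fst_of /snd_of /= surj_is_hom. Qed.

Lemma pair_map_surj u q : exists p, @pair_map u p = q.
Proof.
case: q => [[x y] xy]; have [a [b [ax bY ab]]] := xy.
by exists (mk_pair ab); apply: pair_ext.
Qed.

Definition pair_surj u := SurjHom (@pair_map_hom u) (@pair_map_surj u).

Lemma pair_map_diag u a : @pair_map u (diag _ a) = diag _ (h a).
Proof. exact: pair_ext. Qed.

(** Delta2 is pulled back along [pair_map] in one direction and pushed forward in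
    the other; the kernel of [pair_map], which enters the direct image, preserves
    every preimage of a congruence of B. *)
Lemma central_preim t u e :
  central (image_joinKer h t) (image_joinKer h u) e <->
  central (t `|` Ker h)%O (u `|` Ker h)%O (preim_congr h e).
Proof.
split=> ce.
  apply: (@central_of _ _ _ _ (preim_congr (pair_surj u) (Delta2 _ (image_joinKer h t)))).
    move=> x y /image_joinKerE /(Delta2_diag (image_joinKer h u)).
    by rewrite -!pair_map_diag.
  by move=> p q /ce.
apply: (@central_of _ _ _ _ (image_joinKer (pair_surj u) (Delta2 _ (t `|` Ker h)%O))).
  move=> _ _ [a [b [<- <- ab]]].
  exists (diag _ a), (diag _ b); split; try exact: pair_map_diag.
  by apply: (congr_leE (leUl _ _)); exact: Delta2_diag.
move=> _ _ [p [q [<- <- pq]]] ep.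
apply: (preserves_join ce _ pq) => // x y /= xy.
have xy1 : h (fst_of x) = h (fst_of y) := congr1 fst_of xy.
have xy2 : h (snd_of x) = h (snd_of y) := congr1 snd_of xy.
by rewrite xy1 xy2.
Qed.

End Surjection.

(** * The commutator of centrality and the primality of maximal congruences *)

Definition centralizer_commutator : congr_op2 s :=
  fun A t u => Meet [set d | central t u d].

(** The congruences modulo which t centralizes u form a principal filter: they
    are closed under meets and upward closed. *)
Lemma centralizer_commutatorP (A : algebra s) (t u d : congr A) : V A ->
  central t u d <-> (centralizer_commutator t u <= d)%O.
Proof.
move=> VA; split=> [cd|]; first exact: Meet_le.
by apply: central_up => //; apply: central_Meet.
Qed.

Lemma preim_image (A B : algebra s) (h : surj_hom A B) (t : congr A) :
  preim_congr h (image_joinKer h t) = (t `|` Ker h)%O.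
Proof.
apply: congr_ext => a b; split=> [[c [d [ca db cd]]]|]; last exact: image_joinKerE.
exact: joinKerE cd.
Qed.

Lemma preim_le (A B : algebra s) (h : surj_hom A B) (e e' : congr B) :
  (e <= e')%O -> (preim_congr h e <= preim_congr h e')%O.
Proof. by move=> /congr_leE ee'; apply/congr_leP => a b; exact: ee'. Qed.

Lemma Ker_le_preim (A B : algebra s) (h : surj_hom A B) (e : congr B) :
  (Ker h <= preim_congr h e)%O.
Proof. exact/preim_le/le0x. Qed.

Lemma centralizer_commutator_like : commutator_like V centralizer_commutator.
Proof.
split=> [A t u VA|A B h t u VA VB].
  by apply/centralizer_commutatorP => //; exact: central_meet.
apply/le_anti/andP; split.
  rewrite leUx Ker_le_preim andbT; apply/centralizer_commutatorP => //.
  apply: (centralS (leUl t (Ker h)) (leUl u (Ker h))).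
  by apply/central_preim/centralizer_commutatorP.
rewrite -preim_image; apply: preim_le.
apply/centralizer_commutatorP => //; apply/central_preim; rewrite preim_image.
apply: central_join => //; last exact: leUr.
by apply/centralizer_commutatorP => //; exact: leUl.
Qed.

Hypothesis V_semidegenerate : semidegenerate V.

(** If Nabla centralizes itself, the diagonal is a class of Delta2, hence an
    idempotent element of the quotient of the square; the quotient is then
    trivial and every pair is on the diagonal. *)
Lemma nabla_not_central (B : algebra s) : V B ->
  central (\top : congr B)%O \top%O \bot%O -> forall a b : B, a = b.
Proof.
move=> VB cB a b.
set T := Delta2 (\top%O : congr B) (\top%O : congr B) in cB.
have diagT x y : T (diag \top%O x) (diag \top%O y) by exact: Delta2_diag.
pose Q := quot_algebra T.
have VQ : V Q.
  exact: (variety_image V_variety (quot_surj T) (pair_variety _ V_variety VB)).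
pose ab : pair_algebra (\top%O : congr B) := @mk_pair _ _ \top%O a b I.
suff : T (diag \top%O a) ab by move/cB; exact.
apply/quot_piP/not_notP => neq.
apply: (V_semidegenerate VQ); first by eexists _, _; exact: neq.
exists (quot_pi T (diag _ a)); split; first by exists (quot_pi T (diag _ a)).
move=> f z za; have -> : z = (fun=> quot_pi T (diag _ a)) by apply/funext.
have /= <- := quot_pi_hom T (fun _ : 'I_(arity f) => diag \top%O a).
apply/quot_piP; have := diagT (op (fun _ : 'I_(arity f) => a)) a.
by congr (T _ _); exact: pair_ext.
Qed.

Variable C : congr_op2 s.
Hypothesis C_commutator : is_commutator V C.
Variable A : algebra s.
Hypothesis VA : V A.

(** If t and u are not below the maximal p, both become Nabla in the quotient
    by p, and [t, u] <= p would give [Nabla, Nabla] = Delta there. *)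
Lemma maximal_prime (p : congr A) : p <> \top%O ->
  (forall q, (p <= q)%O -> q <> \top%O -> q = p) -> prime_congr (@C A) p.
Proof.
move=> pT pmax; split=> // t u tup; apply: contrapT => /not_orP[tp up]; apply: pT.
pose h := quot_surj p; pose B := quot_algebra p.
have VB : V B by exact: (variety_image V_variety h VA).
have kp : Ker h = p by apply: congr_ext => a b; exact: quot_piP.
have top_image v : ~ (v <= p)%O -> image_joinKer h v = \top%O.
  move=> vp; apply/le_anti; rewrite lex1 /=; apply/congr_leP => x y _.
  have [a <-] := surj_surj h x; have [b <-] := surj_surj h y.
  apply: image_joinKerE; rewrite kp.
  have -> // : (v `|` p)%O = \top%O.
  apply: contrapT => vpT; apply: vp; rewrite -(pmax _ (leUr _ _) vpT).
  exact: leUl.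
have [[_ Cpreim] Cmax] := C_commutator.
have := Cpreim _ _ h t u VA VB; rewrite kp !top_image //.
have -> : (@C A t u `|` p)%O = p by apply/eqP; rewrite eq_joinr.
move=> Ep; apply/le_anti; rewrite lex1 /=; apply/congr_leP => a b _.
suff /quot_piP : quot_pi p a = quot_pi p b by [].
apply: (nabla_not_central VB); apply/centralizer_commutatorP => //.
apply: le_trans (Cmax _ centralizer_commutator_like _ VB _ _) _.
apply/congr_leP => x y; have [c <-] := surj_surj h x; have [d <-] := surj_surj h y.
move=> cd; apply/quot_piP; rewrite Ep; exact: cd.
Qed.

Lemma prime_above (t : congr A) : t <> \top%O ->
  exists2 p, prime_congr (@C A) p & (t <= p)%O.
Proof.
move=> tT.
pose X := {q : congr A | (t <= q)%O /\ q <> \top%O}.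
pose R (x y : X) : bool := (sval x <= sval y)%O.
have [||||[p [tp pT]] pmax] := @Zorn X R.
- by move=> x; exact: lexx.
- by move=> x y z; exact: le_trans.
- move=> [x xP] [y yP] xy yx; apply: eq_exist.
  by apply/le_anti/andP; split.
- move=> c c_total.
  (* Adding t keeps the join above t when the chain c is empty. *)
  pose S := [set sval x | x in c] `|` [set t].
  have ST : Join S <> \top%O.
    move=> E.
    have topS : ((\top : congr A) <= Join S)%O by rewrite E.
    have [F [FS finF]] := semidegenerate_compact V_variety V_semidegenerate VA topS.
    rewrite le1x => /eqP FT.
    suff [q [tq qT] Fq] : exists2 q, (t <= q)%O /\ q <> \top%O & (Join F <= q)%O.
      by apply: qT; apply/eqP; rewrite -le1x -FT.
    suff [q Sq Fq] : exists2 q, S q & (Join F <= q)%O.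
      by exists q => //; case: Sq => [[x _ <-]|->]; [exact: (svalP x)|].
    apply: (finite_Join_ind (P := fun v => exists2 q, S q & (v <= q)%O)) => //.
    - by exists t; [right|exact: le0x].
    - move=> v w [x Sx vx] [y Sy wy].
      have [xy|yx] : (x <= y)%O \/ (y <= x)%O.
        case: Sx Sy => [[x' cx <-]|->] [[y' cy <-]|->].
        + exact: c_total.
        + by right; have [] := svalP x'.
        + by left; have [] := svalP y'.
        + by left.
      + by exists y => //; rewrite leUx (le_trans vx xy).
      + by exists x => //; rewrite leUx vx (le_trans wy yx).
    - by move=> v /FS Sv; exists v.
  have tS : (t <= Join S)%O by apply: le_Join; right.
  exists (exist _ (Join S) (conj tS ST)) => x cx.
  by apply: le_Join; left; exists x.
exists p => //; apply: maximal_prime => // q pq qT.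
have tq := le_trans tp pq.
by have [] := pmax (exist _ q (conj tq qT)) pq.
Qed.

End Centrality.

(** * Complemented congruences and the reticulation *)

Lemma complementedU d (L : tbDistrLatticeType d) (x y : L) :
  complemented x -> complemented y -> complemented (x `|` y)%O.
Proof.
move=> [x' [xx' xx'T]] [y' [yy' yy'T]]; exists (x' `&` y')%O; split.
  by rewrite meetUl meetA xx' meet0x meetCA yy' meetx0 joinx0.
by rewrite joinIr joinAC xx'T join1x -joinA yy'T joinx1 meetx1.
Qed.

Section ComplementedCongruences.
Variables (s : signature) (A : algebra s) (C : congr A -> congr A -> congr A).
Hypotheses (A_modular : modular (congr A)) (h : reticulable C).
Implicit Types (t u v k : congr A).

Lemma compact_principal t a b : t a b ->
  exists k, [/\ compact k, (k <= t)%O & k a b].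
Proof.
move=> tab; exists (Meet [set u | u a b]); split=> [S|| u //]; last exact: Meet_le.
move=> /congr_leE /(_ a b (fun u => id)) /Join_finite[F [FS finF Fab]].
by exists F; split=> //; exact: Meet_le.
Qed.

Lemma le_Join_compact t : (t <= Join [set k | compact k /\ (k <= t)%O])%O.
Proof.
apply/congr_leP => a b /compact_principal[k [ck kt kab]].
by apply: congr_leE kab; exact: le_Join.
Qed.

Lemma le_common_complement_eq t k v : (k <= t)%O ->
  (t `&` v)%O = \bot%O -> (k `|` v)%O = \top%O -> t = k.
Proof.
move=> kt tv kv; apply/esym; rewrite -[RHS]meet1x -kv -A_modular //.
by rewrite meetC tv joinx0.
Qed.

(** The top is the join of v and the compact congruences below t; finitely many
    of these suffice, and their join k satisfies k <= t and k \/ v = 1. *)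
Lemma complemented_compact t : complemented t -> compact t.
Proof.
move=> [v [tv tvT]].
pose S := [set k | compact k /\ (k <= t)%O].
have : (\top <= Join (S `|` [set v]))%O.
  rewrite -tvT leUx; apply/andP; split; last by apply: le_Join; right.
  apply: le_trans (le_Join_compact t) _; apply: Join_sub; exact: subsetUl.
move=> /(ret_top h)[F [FS finF]]; rewrite le1x => /eqP FT.
suff [k [ck kt Fk]] : exists k, [/\ compact k, (k <= t)%O & (Join F <= k `|` v)%O].
  suff -> : t = k by [].
  by apply: (le_common_complement_eq kt tv); apply/eqP; rewrite -le1x -FT.
apply: (finite_Join_ind
  (P := fun u => exists k, [/\ compact k, (k <= t)%O & (u <= k `|` v)%O])) => //.
- by exists \bot%O; split; [exact: compact_bot|exact: le0x|exact: le0x].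
- move=> x y [k [ck kt xk]] [l [cl lt yl]]; exists (k `|` l)%O; split.
  + exact: compact_join.
  + by rewrite leUx kt.
  + rewrite leUx (le_trans xk) ?(le_trans yl) //.
      by rewrite leU2 ?leUr.
    by rewrite leU2 ?leUl.
- move=> u /FS[[cu ut]|->]; first by exists u; split=> //; exact: leUl.
  by exists \bot%O; split; [exact: compact_bot|exact: le0x|exact: leUr].
Qed.

Lemma lam_le (a b : compact_congr A) : (val a <= val b)%O -> (lam h a <= lam h b)%O.
Proof.
move=> ab; rewrite leEjoin lam_join; apply/eqP; congr lam.
by apply: val_inj => /=; apply/eqP; rewrite eq_joinr.
Qed.

Lemma lam_complemented (a : compact_congr A) :
  complemented (val a) -> complemented (lam h a).
Proof.
move=> ca; have [v [av avT]] := ca.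
have cv : complemented v by exists (val a); rewrite meetC joinC.
exists (lam h (mkK (complemented_compact cv))); rewrite lam_meet lam_join.
split; apply/eqP; [rewrite -lex0|rewrite -le1x]; apply: lam_le => /=.
  by rewrite -av; exact: ret_le_meet.
by rewrite avT.
Qed.

Lemma star_ideal t : lattice_ideal (star h t).
Proof.
split.
- by exists (@Kbot _ A) => //=; exact: le0x.
- move=> x y xy [b /= bt yE]; rewrite -yE in xy.
  have [a ax] : exists a, lam h a = x by exists (repr x); exact: reprK.
  exists (Kcomm h a b); last by rewrite -lam_meet ax; apply/eqP; rewrite eq_meetl.
  apply: le_trans bt; apply: le_trans (ret_le_meet h _ _) _; exact: leIr.
- move=> _ _ [a a_t <-] [b bt <-]; exists (Kjoin a b); last by rewrite lam_join.
  by rewrite /= leUx; apply/andP.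
Qed.

Lemma regular_star t : regular_congruence t -> regular_ideal (star h t).
Proof.
move=> [S [Sc ->]]; split; first exact: star_ideal.
exists [set lam h a | a in [set a | S (val a)]]; split.
  by move=> _ [a Sa <-]; apply: lam_complemented; exact: Sc.
apply/seteqP; split=> [_ [a /= aS <-] J [J0 Jle JU] SJ|x].
  have [F [FS finF aF]] := compactP aS.
  suff [b bF Jb] : exists2 b : compact_congr A, val b = Join F & J (lam h b).
    by apply: Jle Jb; apply: lam_le; rewrite bF.
  apply: (finite_Join_ind
    (P := fun u => exists2 b : compact_congr A, val b = u & J (lam h b))) => //.
  - by exists (@Kbot _ A).
  - move=> _ _ [b <- Jb] [c <- Jc]; exists (Kjoin b c) => //.
    by rewrite -lam_join; exact: JU.
  - move=> u /FS Su; pose b := mkK (complemented_compact (Sc _ Su)).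
    by exists b => //; apply: SJ; exists b.
apply; first exact: star_ideal.
by move=> _ [a Sa <-]; exists a => //=; exact: le_Join.
Qed.

Hypothesis prime_above_proper : forall t, t <> \top%O ->
  exists2 p, prime_congr C p & (t <= p)%O.
Hypothesis C_semiprime : semiprime C.

Lemma le_prime t : (forall p, prime_congr C p -> (t <= p)%O) -> t = \bot%O.
Proof.
move=> H; apply/eqP; rewrite -lex0 -C_semiprime.
by apply/le_Meet => p [pp _]; exact: H.
Qed.

(** Both directions use that the primes above [a, b] are those above a or
    above b. *)
Lemma lam_leP (a b : compact_congr A) : (lam h a <= lam h b)%O <->
  forall p, prime_congr C p -> (val b <= p)%O -> (val a <= p)%O.
Proof.
split=> [ab p pp bp|H].
  move: ab; rewrite leEmeet => /eqP; rewrite lam_meet => /lamP E.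
  have : [set p | prime_congr C p /\ (C (val a) (val b) <= p)%O] p.
    split=> //; apply: le_trans (ret_le_meet h _ _) _.
    by apply: le_trans (leIr _ _) bp.
  by rewrite [X in X p]E => -[].
rewrite leEmeet lam_meet; apply/eqP/lamP/seteqP; split=> p [pp /= Hp]; split=> //.
  by case: (pp.2 _ _ Hp) => //; exact: H.
by apply: le_trans (ret_le_meet h _ _) _; apply: le_trans (leIl _ _) Hp.
Qed.

(** A complement lam b of lam a gives a complement b of a: semiprimeness yields
    a /\ b = 0, and the existence of primes above proper congruences yields
    a \/ b = 1. *)
Lemma complemented_of_lam (a : compact_congr A) :
  complemented (lam h a) -> complemented (val a).
Proof.
move=> [y [ay ayT]].
have [b yE] : exists b, lam h b = y by exists (repr y); exact: reprK.
move: ay ayT; rewrite -yE lam_meet lam_join => ab abT.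
exists (val b); split.
  apply: le_prime => p pp.
  have : (lam h (Kcomm h a b) <= lam h (@Kbot _ A))%O by rewrite ab; exact: lexx.
  move=> /lam_leP /(_ p pp (le0x _)) /(pp.2 _ _) [ap|bp].
    exact: le_trans (leIl _ _) ap.
  exact: le_trans (leIr _ _) bp.
apply: contrapT => /prime_above_proper[p pp abp].
have : (lam h (Ktop h) <= lam h (Kjoin a b))%O by rewrite abT; exact: lexx.
by move=> /lam_leP /(_ p pp abp); rewrite /= le1x => /eqP /(pp.1).
Qed.

(** For k and v complementary, each prime contains k or v, hence contains
    rho k /\ v; so rho k /\ v = 0 and modularity gives rho k = k. *)
Lemma complemented_rho k : complemented k -> rho C k = k.
Proof.
move=> [v [kv kvT]].
apply: le_common_complement_eq kvT; first by apply/le_Meet => p [].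
apply: le_prime => p pp.
have : (C k v <= p)%O.
  by apply: le_trans (ret_le_meet h _ _) _; rewrite kv; exact: le0x.
case/(pp.2 _ _) => [kp|vp]; last exact: le_trans (leIr _ _) vp.
by apply: le_trans (leIl _ _) _; exact: Meet_le.
Qed.

Lemma regular_costar (I : set (reticulation h)) :
  regular_ideal I -> regular_congruence (costar I).
Proof.
move=> [_ [S [Sc IS]]].
pose T := [set val a | a in [set a | S (lam h a)]].
exists T; split; first by move=> _ [a Sa <-]; apply: complemented_of_lam; exact: Sc.
apply/le_anti/andP; split; last first.
  apply: Join_sub => _ [a Sa <-]; exists a => //=.
  by rewrite IS => J _; apply.
apply/Join_le => _ [a /= + <-]; rewrite IS.
(* J is an ideal containing S whose elements are bounded by the image of a
   complemented congruence below Join T; by [complemented_rho] this bound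
   reflects back to congruences. *)
pose J := [set x | exists k : compact_congr A,
  [/\ complemented (lam h k), (val k <= Join T)%O & (x <= lam h k)%O]].
have bot_c : complemented (lam h (@Kbot _ A)).
  by exists \top%O; rewrite meetx1 joinx1.
have J_ideal : lattice_ideal J.
  split.
  - by exists (@Kbot _ A); split=> //; exact: le0x.
  - by move=> x y xy [k [ck kT yk]]; exists k; split=> //; exact: le_trans yk.
  - move=> x y [k [ck kT xk]] [l [cl lT yl]]; exists (Kjoin k l); split.
    + by rewrite -lam_join; exact: complementedU.
    + by rewrite /= leUx kT.
    + by rewrite -lam_join leU2.
have SJ : S `<=` J.
  move=> x Sx.
  have [b bx] : exists b, lam h b = x by exists (repr x); exact: reprK.
  exists b; rewrite bx; split=> //; first exact: Sc.
  by apply: le_Join; exists b => //=; rewrite bx.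
move=> /(_ J J_ideal SJ)[k [ck kT ak]]; apply: le_trans kT.
rewrite -(complemented_rho (complemented_of_lam ck)).
by apply/le_Meet => p [pp kp]; exact: (lam_leP a k).1 ak p pp kp.
Qed.

End ComplementedCongruences.

Theorem proposition6p19 (s : signature) (V : algebra s -> Prop)
    (V_variety : variety V) (V_modular : congruence_modular V)
    (V_semidegenerate : semidegenerate V)
    (C : congr_op2 s) (C_commutator : is_commutator V C)
    (A : algebra s) (VA : V A) (A_closed : compact_closed (C A)) :
  let hA := commutator_reticulable V_variety V_semidegenerate C_commutator
              VA A_closed in
  (forall theta : congr A,
     regular_congruence theta -> regular_ideal (star hA theta)) /\
  (semiprime (C A) ->
   forall I : set (reticulation hA),
     regular_ideal I -> regular_congruence (costar I)).
Proof.
move=> hA; split=> [theta|C_semiprime I]; first exact/regular_star/V_modular.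
apply: regular_costar => //; first exact: V_modular.
exact: (prime_above V_variety V_modular V_semidegenerate C_commutator VA).
Qed.
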